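(* Let $X_1,X_2,\dots$ be random variables such that for each $i\ge1$, $X_i\in\mathcal H_i$, $X_i$ is independent of $\mathcal F_{i-1}$, and $X_i$ is either bounded below or belongs to $L^1_b$. If $\sum_{i=1}^\infty\mathcal E\big((X_i-\mathcal E(X_i))^2\big)<\infty$, then the series $\sum_{i=1}^\infty(X_i-\mathcal E(X_i))$ converges quasi-surely.
   Context: Standing setting. $(\Omega,\mathcal F)$ is a measurable space with a discrete-time filtration $(\mathcal F_t)_{t\in\mathbb N}$, $\mathcal F_0$ trivial and $\mathcal F=\sigma(\bigcup_t\mathcal F_t)$. $\mathcal H$ is a linear space of $\mathcal F$-measurable real functions on $\Omega$ containing the constants, such that $X\in\mathcal H$ implies $|X|\in\mathcal H$ and $I_AX\in\mathcal H$ for all $A\in\mathcal F$; $\mathcal H_t:=\{X\in\mathcal H: X \text{ is } \mathcal F_t\text{-measurable}\}$. $(\mathcal E_t)$ is an $\mathcal{SL}$-expectation (a family of maps $\mathcal E_t:\mathcal H\to\mathcal H_t$ that are monotone, time-consistent $\mathcal E_s\circ\mathcal E_t=\mathcal E_s$ for $s\le t$, satisfy $\mathcal E_t(I_AY)=I_A\mathcal E_t(Y)$ for $A\in\mathcal F_t$, $\mathcal E_t(Y)=Y$ for $Y\in\mathcal H_t$, are subadditive, satisfy $\mathcal E_t(\lambda Y)=\lambda^+\mathcal E_t(Y)+\lambda^-\mathcal E_t(-Y)$ for $\lambda\in\mathcal H_t$, and $\mathcal E_0(X_i)\to0$ whenever $X_i\downarrow0$ pointwise); $\mathcal E:=\mathcal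 E_0$; $\mathbb V(A):=\mathcal E(I_A)$. ''Quasi-surely'' (q.s.) means outside a set $N$ with $\mathcal E(I_N)=0$. Independence: $Y\in\mathcal H$ is independent of $Z=(Z_1,\dots,Z_k)$ under $\mathcal E$ if for every measurable $\varphi$ with $\varphi(Z,Y)\in\mathcal H$ and $\varphi(z,Y)\in\mathcal H$ for all $z$, $\mathcal E[\varphi(Z,Y)]=\mathcal E[\bar\varphi(Z)]$ with $\bar\varphi(z):=\mathcal E[\varphi(z,Y)]$; $X$ is independent of $\mathcal F_n$ if $X$ is independent of $I_A$ for every $A\in\mathcal F_n$. $L^1_b$: the completion of bounded elements of $\mathcal H$ under $\mathcal E(|\cdot|)$, equivalently the $X\in L^1$ with $\lim_n\mathcal E(|X|I_{\{|X|>n\}})=0$. *)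

(* Defs.v *)
From Stdlib Require Import Reals Classical ClassicalEpsilon ClassicalDescription.
Open Scope R_scope.

Definition is_sigma_algebra {T : Type} (F : (T -> Prop) -> Prop) : Prop :=
  F (fun _ => True) /\
  (forall A, F A -> F (fun w => ~ A w)) /\
  (forall A : nat -> T -> Prop, (forall n, F (A n)) -> F (fun w => exists n, A n w)).

Definition gen_sigma {T : Type} (C : (T -> Prop) -> Prop) (A : T -> Prop) : Prop :=
  forall F, is_sigma_algebra F -> (forall B, C B -> F B) -> F A.

Definition Borel : (R -> Prop) -> Prop :=
  gen_sigma (fun B => exists a, forall x, B x <-> x <= a).
Definition Borel2 : (R * R -> Prop) -> Prop :=
  gen_sigma (fun B => exists a b, forall p, B p <-> (fst p <= a /\ snd p <= b)).

Definition measurable {T : Type} (F : (T -> Prop) -> Prop) (X : T -> R) : Prop :=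
  forall B, Borel B -> F (fun w => B (X w)).
Definition measurable2 (phi : R -> R -> R) : Prop :=
  forall B, Borel B -> Borel2 (fun p => B (phi (fst p) (snd p))).

Definition ind {T : Type} (A : T -> Prop) (w : T) : R :=
  if excluded_middle_informative (A w) then 1 else 0.

Definition filtration {Omega : Type} (Ft : nat -> (Omega -> Prop) -> Prop) : Prop :=
  (forall t, is_sigma_algebra (Ft t)) /\
  (forall s t A, (s <= t)%nat -> Ft s A -> Ft t A) /\
  (forall A, Ft 0%nat A -> (forall w, A w) \/ (forall w, ~ A w)).

Definition Finf {Omega : Type} (Ft : nat -> (Omega -> Prop) -> Prop) : (Omega -> Prop) -> Prop :=
  gen_sigma (fun A => exists t, Ft t A).

Record admissible_space {Omega : Type} (Ft : nat -> (Omega -> Prop) -> Prop)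
    (H : (Omega -> R) -> Prop) : Prop := {
  H_meas : forall X, H X -> measurable (Finf Ft) X;
  H_const : forall c : R, H (fun _ => c);
  H_add : forall X Y, H X -> H Y -> H (fun w => X w + Y w);
  H_scal : forall (c : R) X, H X -> H (fun w => c * X w);
  H_abs : forall X, H X -> H (fun w => Rabs (X w));
  H_ind : forall A X, Finf Ft A -> H X -> H (fun w => ind A w * X w)
}.

Definition Ht {Omega : Type} (Ft : nat -> (Omega -> Prop) -> Prop)
    (H : (Omega -> R) -> Prop) (t : nat) (X : Omega -> R) : Prop :=
  H X /\ measurable (Ft t) X.

(** SL-expectation (E_t)_t, E_t : H -> H_t (modelled as total maps; the axioms
    only constrain them on H). *)
Record SL_expectation {Omega : Type} (Ft : nat -> (Omega -> Prop) -> Prop)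
    (H : (Omega -> R) -> Prop) (E : nat -> (Omega -> R) -> Omega -> R) : Prop := {
  E_range : forall t X, H X -> Ht Ft H t (E t X);
  E_mono : forall t X Y, H X -> H Y -> (forall w, X w <= Y w) ->
    forall w, E t X w <= E t Y w;
  E_cons : forall s t X, (s <= t)%nat -> H X -> forall w, E s (E t X) w = E s X w;
  E_ind : forall t A Y, Ft t A -> H Y ->
    forall w, E t (fun w' => ind A w' * Y w') w = ind A w * E t Y w;
  E_id : forall t Y, Ht Ft H t Y -> forall w, E t Y w = Y w;
  E_subadd : forall t X Y, H X -> H Y ->
    forall w, E t (fun w' => X w' + Y w') w <= E t X w + E t Y w;
  E_posh : forall t lam Y, Ht Ft H t lam -> H Y -> H (fun w' => lam w' * Y w') ->
    forall w, E t (fun w' => lam w' * Y w') w =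
      Rmax (lam w) 0 * E t Y w + Rmax (- lam w) 0 * E t (fun w' => - Y w') w;
  E_cont : forall Xs : nat -> Omega -> R, (forall i, H (Xs i)) ->
    (forall i w, Xs (S i) w <= Xs i w) -> (forall w, Un_cv (fun i => Xs i w) 0) ->
    forall w, Un_cv (fun i => E 0%nat (Xs i) w) 0
}.

(** Y independent of Z = I_A under E = E_0 (the independence definition with k = 1). *)
Definition indep_of_ind {Omega : Type} (H : (Omega -> R) -> Prop)
    (E : nat -> (Omega -> R) -> Omega -> R) (Y : Omega -> R) (A : Omega -> Prop) : Prop :=
  forall phi : R -> R -> R, measurable2 phi ->
    H (fun w => phi (ind A w) (Y w)) -> (forall z, H (fun w => phi z (Y w))) ->
    forall w, E 0%nat (fun w' => phi (ind A w') (Y w')) w =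
              E 0%nat (fun w' => E 0%nat (fun w'' => phi (ind A w') (Y w'')) w') w.

Definition indep_of_F {Omega : Type} (Ft : nat -> (Omega -> Prop) -> Prop)
    (H : (Omega -> R) -> Prop) (E : nat -> (Omega -> R) -> Omega -> R)
    (X : Omega -> R) (n : nat) : Prop :=
  forall A, Ft n A -> indep_of_ind H E X A.

Definition L1b {Omega : Type} (H : (Omega -> R) -> Prop)
    (E : nat -> (Omega -> R) -> Omega -> R) (X : Omega -> R) : Prop :=
  H X /\ forall w, Un_cv (fun n => E 0%nat
     (fun w' => Rabs (X w') * ind (fun w'' => Rabs (X w'') > INR n) w') w) 0.

Definition quasi_surely {Omega : Type} (Ft : nat -> (Omega -> Prop) -> Prop)
    (E : nat -> (Omega -> R) -> Omega -> R) (P : Omega -> Prop) : Prop :=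
  exists N, Finf Ft N /\ (forall w, E 0%nat (ind N) w = 0) /\ (forall w, ~ N w -> P w).

(* Main.v *)
(* Write Y_i = X_i - E(X_i), S_n for the partial sums and V(A) = E(I_A).  Given eps,
   let A be the event that for every m some later S_n is more than eps away from S_m.

   Kolmogorov's inequality holds in this weak form: for B in F_m, the event "B, and
   S_n stays within eps of S_m for all n >= m" has upper probability at least
   V(B) - delta_m with delta_m -> 0.  As only a lower bound on an upper expectation
   is claimed, it suffices that E_{i-1}(x Y_i) >= 0 quasi-surely for predictable x of
   either sign, and this follows from E_{i-1}(Y_i) = 0 and subadditivity.

   That event is contained in B \ A, so V(B \ A) >= V(B) - delta_m.  Since V is
   continuous at the empty set, for each eta there are t and B in F_t with
   V(A symdiff B) < eta; letting m -> infinity gives V(B) <= V(B \ A) < eta, hence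
   V(A) < 2 eta. *)
From Stdlib Require Import Reals ZArith Lra Lia Classical ClassicalEpsilon ClassicalDescription.
From Stdlib Require Import FunctionalExtensionality PropExtensionality.
Require Import Defs.
Open Scope R_scope.

(** * Extensionality and indicators *)

Lemma pred_ext {T : Type} (A B : T -> Prop) : (forall w, A w <-> B w) -> A = B.
Proof.
  intros h; extensionality w; apply propositional_extensionality, h.
Qed.

Lemma ind_true {T : Type} (A : T -> Prop) w : A w -> ind A w = 1.
Proof. unfold ind; destruct excluded_middle_informative; tauto. Qed.

Lemma ind_false {T : Type} (A : T -> Prop) w : ~ A w -> ind A w = 0.
Proof. unfold ind; destruct excluded_middle_informative; tauto. Qed.

Ltac indcase A w :=
  let h := fresh "h" in
  destruct (classic (A w)) as [h | h];
  [rewrite ?(ind_true A w h) | rewrite ?(ind_false A w h)].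

Lemma ind_bounds {T : Type} (A : T -> Prop) w : 0 <= ind A w <= 1.
Proof. indcase A w; lra. Qed.

(** * Measurable functions *)

Lemma gen_sigma_algebra {T : Type} (C : (T -> Prop) -> Prop) :
  is_sigma_algebra (gen_sigma C).
Proof.
  split; [|split].
  - intros F hF _; apply hF.
  - intros A hA F hF hC; apply hF, hA; assumption.
  - intros A hA F hF hC; apply hF; intros n; apply hA; assumption.
Qed.

Lemma gen_sigma_base {T : Type} (C : (T -> Prop) -> Prop) A : C A -> gen_sigma C A.
Proof. intros hA F _ hC; apply hC, hA. Qed.

Section SigmaAlgebra.
Variables (T : Type) (F : (T -> Prop) -> Prop).
Hypothesis hF : is_sigma_algebra F.

Lemma sigma_true : F (fun _ => True).
Proof. apply hF. Qed.

Lemma sigma_not A : F A -> F (fun w => ~ A w).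
Proof. apply hF. Qed.

Lemma sigma_ex (A : nat -> T -> Prop) : (forall n, F (A n)) -> F (fun w => exists n, A n w).
Proof. apply hF. Qed.

Lemma sigma_ext A B : (forall w, A w <-> B w) -> F A -> F B.
Proof. intros h hA; rewrite <- (pred_ext A B h); exact hA. Qed.

Lemma sigma_all (A : nat -> T -> Prop) : (forall n, F (A n)) -> F (fun w => forall n, A n w).
Proof.
  intros hA.
  apply (sigma_ext (fun w => ~ exists n, ~ A n w)).
  - intros w; split.
    + intros h n; apply NNPP; intros hn; apply h; exists n; exact hn.
    + intros h [n hn]; apply hn, h.
  - apply sigma_not, sigma_ex; intros n; apply sigma_not, hA.
Qed.

Lemma sigma_const (P : Prop) : F (fun _ => P).
Proof.
  destruct (classic P) as [h | h].
  - apply (sigma_ext (fun _ => True)); [tauto | apply sigma_true].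
  - apply (sigma_ext (fun _ => ~ True)); [tauto | apply sigma_not, sigma_true].
Qed.

Lemma sigma_or A B : F A -> F B -> F (fun w => A w \/ B w).
Proof.
  intros hA hB.
  apply (sigma_ext (fun w => exists n : nat, (match n with O => A | _ => B end) w)).
  - intros w; split.
    + intros [[|n] h]; tauto.
    + intros [h | h]; [exists O | exists 1%nat]; exact h.
  - apply (sigma_ex (fun n => match n with O => A | _ => B end)); intros [|n]; assumption.
Qed.

Lemma sigma_and A B : F A -> F B -> F (fun w => A w /\ B w).
Proof.
  intros hA hB.
  apply (sigma_ext (fun w => ~ (~ A w \/ ~ B w))).
  - intros w; tauto.
  - apply sigma_not, sigma_or; apply sigma_not; assumption.
Qed.

(** The sets whose preimage lies in [F] form a sigma-algebra, so checking the half-lines that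
    generate [Borel] is enough. *)
Lemma measurable_le_intro (X : T -> R) : (forall a, F (fun w => X w <= a)) -> measurable F X.
Proof.
  intros h B hB.
  apply (hB (fun B => F (fun w => B (X w)))).
  - split; [|split].
    + apply sigma_true.
    + intros A; apply sigma_not.
    + intros A; apply (sigma_ex (fun n w => A n (X w))).
  - intros A [a hA].
    apply (sigma_ext (fun w => X w <= a)); [|apply h].
    intros w; symmetry; apply hA.
Qed.

Lemma measurable_le (X : T -> R) a : measurable F X -> F (fun w => X w <= a).
Proof.
  intros h; apply (h (fun x => x <= a)), gen_sigma_base; exists a; tauto.
Qed.

Lemma measurable_gt (X : T -> R) a : measurable F X -> F (fun w => X w > a).
Proof.
  intros h; apply (sigma_ext (fun w => ~ X w <= a)).
  - intros w; split; intros; lra.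
  - apply sigma_not, measurable_le, h.
Qed.

Lemma measurable_lt (X : T -> R) a : measurable F X -> F (fun w => X w < a).
Proof.
  intros h; apply (sigma_ext (fun w => exists n : nat, X w <= a - / INR (S n))).
  - intros w; split.
    + intros [n hn]; assert (0 < / INR (S n)) by apply Rinv_0_lt_compat, lt_0_INR, Nat.lt_0_succ; lra.
    + intros hw; destruct (archimed_cor1 (a - X w)) as [n [hn h0]]; [lra|].
      exists (pred n); replace (S (pred n)) with n by lia; lra.
  - apply sigma_ex; intros n; apply measurable_le, h.
Qed.

Lemma measurable_ge (X : T -> R) a : measurable F X -> F (fun w => a <= X w).
Proof.
  intros h; apply (sigma_ext (fun w => ~ X w < a)).
  - intros w; split; intros; lra.
  - apply sigma_not, measurable_lt, h.
Qed.

Lemma measurable_const (c : R) : measurable F (fun _ => c).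
Proof. apply measurable_le_intro; intros a; apply sigma_const. Qed.

(** Rationals are coded by three naturals so that a union over them is three nested uses of
    [sigma_ex], as in [measurable_add]. *)
Lemma rational_between (x y : R) : x < y ->
  exists p q r : nat, x < (INR p - INR q) / INR (S r) < y.
Proof.
  intros hxy.
  destruct (archimed_cor1 (y - x)) as [n [hn h0]]; [lra|].
  pose (z := up (x * INR n)).
  assert (hz : IZR z > x * INR n /\ IZR z - x * INR n <= 1) by apply archimed.
  assert (hpn : 0 < INR n) by (apply lt_0_INR; lia).
  assert (hzz : exists p q, IZR z = INR p - INR q).
  { destruct (Z.le_gt_cases 0 z).
    - exists (Z.to_nat z), O; rewrite INR_IZR_INZ, Z2Nat.id by lia; simpl; lra.
    - exists O, (Z.to_nat (- z)); rewrite (INR_IZR_INZ (Z.to_nat _)), Z2Nat.id by lia.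
      rewrite opp_IZR; simpl; lra. }
  destruct hzz as [p [q hpq]].
  exists p, q, (pred n); replace (S (pred n)) with n by lia.
  rewrite <- hpq.
  assert (hi : / INR n * INR n = 1) by (field; lra).
  assert (0 < / INR n) by (apply Rinv_0_lt_compat; lra).
  unfold Rdiv; split.
  - apply Rmult_lt_reg_r with (INR n); [lra|]. rewrite Rmult_assoc, hi; lra.
  - apply Rmult_lt_reg_r with (INR n); [lra|]. rewrite Rmult_assoc, hi.
    assert ((y - x) * INR n > 1) by (rewrite <- hi; apply Rmult_gt_compat_r; lra).
    lra.
Qed.

Lemma measurable_add (X Y : T -> R) :
  measurable F X -> measurable F Y -> measurable F (fun w => X w + Y w).
Proof.
  intros hX hY; apply measurable_le_intro; intros a.
  apply (sigma_ext (fun w => ~ exists p q r : nat,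
    X w > (INR p - INR q) / INR (S r) /\ Y w > a - (INR p - INR q) / INR (S r))).
  - intros w; split.
    + intros h; apply Rnot_lt_le; intros hw; apply h.
      destruct (rational_between (a - Y w) (X w)) as [p [q [r hr]]]; [lra|].
      exists p, q, r; lra.
    + intros h [p [q [r hr]]]; lra.
  - apply sigma_not.
    apply sigma_ex; intros p; apply sigma_ex; intros q; apply sigma_ex; intros r.
    apply sigma_and; apply measurable_gt; assumption.
Qed.

Lemma measurable_scal (c : R) (X : T -> R) :
  measurable F X -> measurable F (fun w => c * X w).
Proof.
  intros hX; apply measurable_le_intro; intros a.
  destruct (Rtotal_order c 0) as [h | [h | h]].
  - apply (sigma_ext (fun w => a / c <= X w)); [|apply measurable_ge, hX].
    intros w; replace a with (c * (a / c)) at 2 by (field; lra); split; intros; nra.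
  - subst c; apply (sigma_ext (fun w => 0 <= a)); [|apply sigma_const].
    intros w; rewrite Rmult_0_l; tauto.
  - apply (sigma_ext (fun w => X w <= a / c)); [|apply measurable_le, hX].
    intros w; replace a with (c * (a / c)) at 2 by (field; lra); split; intros; nra.
Qed.

Lemma measurable_sub (X Y : T -> R) :
  measurable F X -> measurable F Y -> measurable F (fun w => X w - Y w).
Proof.
  intros hX hY.
  replace (fun w => X w - Y w) with (fun w => X w + -1 * Y w) by (extensionality w; lra).
  apply measurable_add; [|apply measurable_scal]; assumption.
Qed.

Lemma measurable_ind_mult (A : T -> Prop) (X : T -> R) :
  F A -> measurable F X -> measurable F (fun w => ind A w * X w).
Proof.
  intros hA hX; apply measurable_le_intro; intros a.
  apply (sigma_ext (fun w => (A w /\ X w <= a) \/ (~ A w /\ 0 <= a))).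
  - intros w; indcase A w.
    + rewrite Rmult_1_l; tauto.
    + rewrite Rmult_0_l; tauto.
  - apply sigma_or; apply sigma_and; try (apply sigma_not); try assumption;
      [apply measurable_le, hX | apply sigma_const].
Qed.

Lemma measurable_ind (A : T -> Prop) : F A -> measurable F (ind A).
Proof.
  intros hA; replace (ind A) with (fun w => ind A w * 1) by (extensionality w; lra).
  apply measurable_ind_mult; [exact hA | apply measurable_const].
Qed.

Lemma measurable_abs (X : T -> R) : measurable F X -> measurable F (fun w => Rabs (X w)).
Proof.
  intros hX; apply measurable_le_intro; intros a.
  apply (sigma_ext (fun w => X w <= a /\ - a <= X w)).
  - intros w; unfold Rabs; destruct Rcase_abs; split; intros; lra.
  - apply sigma_and; [apply measurable_le | apply measurable_ge]; exact hX.
Qed.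

(** Together with sums and differences this yields products by polarization. *)
Lemma measurable_sqr (X : T -> R) : measurable F X -> measurable F (fun w => X w * X w).
Proof.
  intros hX; apply measurable_le_intro; intros a.
  apply (sigma_ext (fun w => 0 <= a /\ Rabs (X w) <= sqrt a)).
  - intros w; split.
    + intros [ha h]; rewrite <- (sqrt_sqrt a ha), <- (Rabs_pos_eq (X w * X w)) by nra.
      rewrite Rabs_mult; pose proof (Rabs_pos (X w)); nra.
    + intros h; assert (0 <= a) by nra; split; [assumption|].
      rewrite <- sqrt_Rsqr_abs; apply sqrt_le_1_alt; exact h.
  - apply sigma_and; [apply sigma_const | apply measurable_le, measurable_abs, hX].
Qed.

End SigmaAlgebra.

(** [Borel2] is generated by quadrants; a half-plane is a countable union of them. *)
Lemma measurable_fst : measurable Borel2 (@fst R R).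
Proof.
  pose proof (gen_sigma_algebra (fun B : R * R -> Prop =>
    exists a b, forall p, B p <-> (fst p <= a /\ snd p <= b))) as h.
  apply (measurable_le_intro _ _ h); intros a.
  apply (sigma_ext _ _ (fun p => exists n, fst p <= a /\ snd p <= INR n)).
  - intros p; split; [intros [n hn]; tauto|].
    intros hp; destruct (INR_unbounded (snd p)) as [n hn]; exists n; lra.
  - apply (sigma_ex _ _ h (fun n p => fst p <= a /\ snd p <= INR n)); intros n.
    apply gen_sigma_base; exists a, (INR n); tauto.
Qed.

Lemma measurable_snd : measurable Borel2 (@snd R R).
Proof.
  pose proof (gen_sigma_algebra (fun B : R * R -> Prop =>
    exists a b, forall p, B p <-> (fst p <= a /\ snd p <= b))) as h.
  apply (measurable_le_intro _ _ h); intros a.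
  apply (sigma_ext _ _ (fun p => exists n, fst p <= INR n /\ snd p <= a)).
  - intros p; split; [intros [n hn]; tauto|].
    intros hp; destruct (INR_unbounded (fst p)) as [n hn]; exists n; lra.
  - apply (sigma_ex _ _ h (fun n p => fst p <= INR n /\ snd p <= a)); intros n.
    apply gen_sigma_base; exists (INR n), a; tauto.
Qed.

(** * Sublinear expectations *)

Section Expectation.
Variables (Omega : Type) (Ft : nat -> (Omega -> Prop) -> Prop)
  (H : (Omega -> R) -> Prop) (E : nat -> (Omega -> R) -> Omega -> R) (w0 : Omega).
Hypotheses (hFt : filtration Ft) (hH : admissible_space Ft H) (hE : SL_expectation Ft H E).

(* [E 0 Z] is a constant function because [Ft 0] is trivial (see [E0_const]). *)
Let e (Z : Omega -> R) : R := E 0%nat Z w0.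
Let V (A : Omega -> Prop) : R := e (ind A).

Lemma Finf_sigma : is_sigma_algebra (Finf Ft).
Proof. apply gen_sigma_algebra. Qed.

Lemma Ft_sigma t : is_sigma_algebra (Ft t).
Proof. apply hFt. Qed.

Lemma Ft_Finf t A : Ft t A -> Finf Ft A.
Proof. intros h; apply gen_sigma_base; exists t; exact h. Qed.

Lemma Ft_mono s t A : (s <= t)%nat -> Ft s A -> Ft t A.
Proof. apply hFt. Qed.

(** For each [v], the set where [E 0 Z] is at most its value at [v] belongs to the trivial [Ft 0]
    and contains [v], hence is everything. *)
Lemma E0_const Z w : H Z -> E 0%nat Z w = e Z.
Proof.
  intros hZ; destruct (E_range _ _ _ hE 0%nat Z hZ) as [_ hm].
  assert (h : forall v v', E 0%nat Z v' <= E 0%nat Z v).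
  { intros v v'.
    destruct (proj2 (proj2 hFt) _ (measurable_le _ _ _ (E 0%nat Z v) hm)) as [h | h].
    - apply h.
    - destruct (h v); lra. }
  apply Rle_antisym; apply h.
Qed.

Lemma H_sub Y Z : H Y -> H Z -> H (fun w => Y w - Z w).
Proof.
  intros hY hZ.
  replace (fun w => Y w - Z w) with (fun w => Y w + -1 * Z w) by (extensionality w; lra).
  apply (H_add _ _ hH); [|apply (H_scal _ _ hH)]; assumption.
Qed.

Lemma H_shift Z c : H Z -> H (fun w => Z w + c).
Proof. intros hZ; apply (H_add _ _ hH); [exact hZ | apply (H_const _ _ hH)]. Qed.

Lemma H_opp Z : H Z -> H (fun w => - Z w).
Proof.
  intros hZ; replace (fun w => - Z w) with (fun w => -1 * Z w) by (extensionality w; lra).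
  apply (H_scal _ _ hH), hZ.
Qed.

Lemma H_indicator A : Finf Ft A -> H (ind A).
Proof.
  intros hA; replace (ind A) with (fun w => ind A w * 1) by (extensionality w; lra).
  apply (H_ind _ _ hH); [exact hA | apply (H_const _ _ hH)].
Qed.

Lemma e_mono Y Z : H Y -> H Z -> (forall w, Y w <= Z w) -> e Y <= e Z.
Proof. intros; apply (E_mono _ _ _ hE); assumption. Qed.

Lemma e_add Y Z : H Y -> H Z -> e (fun w => Y w + Z w) <= e Y + e Z.
Proof. intros; apply (E_subadd _ _ _ hE); assumption. Qed.

Lemma Ht_const t c : Ht Ft H t (fun _ => c).
Proof. split; [apply (H_const _ _ hH) | apply measurable_const, Ft_sigma]. Qed.

Lemma e_const c : e (fun _ => c) = c.
Proof. unfold e; rewrite (E_id _ _ _ hE); [reflexivity | apply Ht_const]. Qed.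

Lemma e_sub Y Z : H Y -> H Z -> e Y - e Z <= e (fun w => Y w - Z w).
Proof.
  intros hY hZ; pose proof (e_add _ Z (H_sub Y Z hY hZ) hZ) as h; cbv beta in h.
  replace (fun w => Y w - Z w + Z w) with Y in h by (extensionality w; lra).
  lra.
Qed.

Lemma e_nonneg Z : H Z -> (forall w, 0 <= Z w) -> 0 <= e Z.
Proof.
  intros hZ h; rewrite <- (e_const 0); apply e_mono; [apply (H_const _ _ hH) | |]; assumption.
Qed.

Lemma e_scal c Z : 0 <= c -> H Z -> e (fun w => c * Z w) = c * e Z.
Proof.
  intros hc hZ; unfold e.
  rewrite (E_posh _ _ _ hE 0%nat (fun _ => c) Z (Ht_const _ c) hZ (H_scal _ _ hH c Z hZ)).
  rewrite Rmax_left by lra; rewrite Rmax_right by lra; lra.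
Qed.

(** Subadditivity is applied once with [Z] and once with [- Z], both of which [E t] fixes. *)
Lemma E_translate t Y Z w : H Y -> Ht Ft H t Z ->
  E t (fun w => Y w + Z w) w = E t Y w + Z w.
Proof.
  intros hY hZ; assert (hZ' : Ht Ft H t (fun w => - Z w)).
  { split; [apply H_opp, hZ|].
    replace (fun w => - Z w) with (fun w => -1 * Z w) by (extensionality v; lra).
    apply measurable_scal; [apply Ft_sigma | apply hZ]. }
  apply Rle_antisym.
  - rewrite <- (E_id _ _ _ hE t Z hZ w).
    apply (E_subadd _ _ _ hE); [exact hY | apply hZ].
  - pose proof (E_subadd _ _ _ hE t (fun w => Y w + Z w) (fun w => - Z w)
      (H_add _ _ hH _ _ hY (proj1 hZ)) (proj1 hZ') w) as h; cbv beta in h.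
    rewrite (E_id _ _ _ hE t _ hZ' w) in h.
    replace (fun w => Y w + Z w + - Z w) with Y in h by (extensionality v; lra).
    lra.
Qed.

Lemma e_shift Z c : H Z -> e (fun w => Z w + c) = e Z + c.
Proof. intros hZ; apply (E_translate 0 Z (fun _ => c)); [exact hZ | apply Ht_const]. Qed.

Lemma e_tower t Z : H Z -> e (E t Z) = e Z.
Proof. intros hZ; apply (E_cons _ _ _ hE); [lia | exact hZ]. Qed.

Lemma e_cont (Z : nat -> Omega -> R) : (forall i, H (Z i)) ->
  (forall i w, Z (S i) w <= Z i w) -> (forall w, Un_cv (fun i => Z i w) 0) ->
  Un_cv (fun i => e (Z i)) 0.
Proof. intros; apply (E_cont _ _ _ hE); assumption. Qed.

(** * The upper probability: subadditivity, null sets, approximation of events *)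

Lemma V_mono A B : Finf Ft A -> Finf Ft B -> (forall w, A w -> B w) -> V A <= V B.
Proof.
  intros hA hB h; apply e_mono; try (apply H_indicator; assumption).
  intros w; indcase A w; [rewrite ind_true by auto; lra | apply ind_bounds].
Qed.

Lemma V_nonneg A : Finf Ft A -> 0 <= V A.
Proof. intros hA; apply e_nonneg; [apply H_indicator, hA | intros; apply ind_bounds]. Qed.

Lemma V_or A B : Finf Ft A -> Finf Ft B -> V (fun w => A w \/ B w) <= V A + V B.
Proof.
  intros hA hB.
  apply Rle_trans with (e (fun w => ind A w + ind B w)).
  - apply e_mono.
    + apply H_indicator, sigma_or; try assumption; apply Finf_sigma.
    + apply (H_add _ _ hH); apply H_indicator; assumption.
    + intros w; pose proof (ind_bounds B w); pose proof (ind_bounds A w).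
      indcase A w; [rewrite ind_true by auto; lra|].
      indcase B w; [rewrite ind_true by auto; lra|].
      rewrite ind_false by tauto; lra.
  - apply e_add; apply H_indicator; assumption.
Qed.

Lemma V_cont (A : nat -> Omega -> Prop) : (forall n, Finf Ft (A n)) ->
  (forall n w, A (S n) w -> A n w) -> (forall w, exists n, ~ A n w) ->
  Un_cv (fun n => V (A n)) 0.
Proof.
  intros hA hdec hempty; apply e_cont.
  - intros n; apply H_indicator, hA.
  - intros n w; indcase (A (S n)) w; [rewrite ind_true by auto; lra | apply ind_bounds].
  - intros w eps heps; destruct (hempty w) as [n hn]; exists n; intros m hm.
    assert (hm' : ~ A m w) by (induction hm; auto).
    rewrite ind_false by exact hm'; unfold Rdist; rewrite Rminus_diag, Rabs_R0; exact heps.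
Qed.

Definition union_upto (A : nat -> Omega -> Prop) (n : nat) (w : Omega) : Prop :=
  exists k, (k <= n)%nat /\ A k w.

Lemma union_upto_0 A : union_upto A 0 = A 0%nat.
Proof.
  apply pred_ext; intros w; split; [intros [k [hk ha]]; replace O with k by lia; exact ha|].
  intros ha; exists O; auto.
Qed.

Lemma union_upto_S A n : union_upto A (S n) = fun w => union_upto A n w \/ A (S n) w.
Proof.
  apply pred_ext; intros w; split.
  - intros [k [hk ha]]; destruct (Nat.eq_dec k (S n)) as [-> | hne]; [tauto|].
    left; exists k; split; [lia | exact ha].
  - intros [[k [hk ha]] | ha]; [exists k | exists (S n)]; split; auto.
Qed.

Lemma Finf_union_upto A n : (forall n, Finf Ft (A n)) -> Finf Ft (union_upto A n).
Proof.
  intros hA; induction n as [|n IH]; [rewrite union_upto_0; auto|].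
  rewrite union_upto_S; apply sigma_or; auto; apply Finf_sigma.
Qed.

(** What the first [n] sets miss of the union decreases to the empty set, so [V_cont] applies. *)
Lemma V_union_tail (A : nat -> Omega -> Prop) eta : (forall n, Finf Ft (A n)) -> 0 < eta ->
  exists n, V (fun w => (exists k, A k w) /\ ~ union_upto A n w) < eta.
Proof.
  intros hA heta; pose proof Finf_sigma as hs.
  set (D := fun n w => (exists k, A k w) /\ ~ union_upto A n w).
  assert (hc : Un_cv (fun n => V (D n)) 0).
  { apply V_cont.
    - intros n; apply (sigma_and _ _ hs).
      + apply (sigma_ex _ _ hs), hA.
      + apply (sigma_not _ _ hs), Finf_union_upto, hA.
    - intros n w [h1 h2]; split; auto; intros h; apply h2; rewrite union_upto_S; auto.
    - intros w; destruct (classic (exists n, A n w)) as [[n hn] | h].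
      + exists n; intros [_ h]; apply h; exists n; auto.
      + exists O; intros [h' _]; auto. }
  destruct (hc eta heta) as [n hn]; exists n.
  specialize (hn n (le_n n)); unfold Rdist in hn; rewrite Rminus_0_r in hn.
  pose proof (Rle_abs (V (D n))); unfold D in *; lra.
Qed.

(** Finite unions are null by subadditivity, and the missing tail is arbitrarily small by
    [V_union_tail]. *)
Lemma null_union (A : nat -> Omega -> Prop) : (forall n, Finf Ft (A n)) ->
  (forall n, V (A n) = 0) -> V (fun w => exists n, A n w) = 0.
Proof.
  intros hA h0; pose proof Finf_sigma as hs.
  assert (hU : forall n, Finf Ft (union_upto A n)) by (intros; apply Finf_union_upto, hA).
  assert (hV : forall n, V (union_upto A n) <= 0).
  { induction n as [|n IH]; [rewrite union_upto_0, h0; lra|].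
    rewrite union_upto_S; eapply Rle_trans; [apply V_or; auto|]; rewrite h0; lra. }
  assert (hA' : Finf Ft (fun w => exists n, A n w)) by (apply sigma_ex; auto).
  apply Rle_antisym; [|apply V_nonneg, hA'].
  apply le_epsilon; intros eps heps; destruct (V_union_tail A eps hA heps) as [n hn].
  specialize (hV n).
  eapply Rle_trans; [|eapply Rle_trans;
    [apply (V_or _ _ (hU n) (sigma_and _ _ hs _ _ hA' (sigma_not _ _ hs _ (hU n))))|lra]].
  apply V_mono; auto; [|intros w hw; tauto].
  apply sigma_or; auto; apply sigma_and; auto; apply sigma_not; auto.
Qed.

(** At each point the integrand decreases in [n] and is eventually 0, which is the situation of
    [E_cont]. *)
Lemma tail_integral_cv Z : H Z ->
  Un_cv (fun n => e (fun w => ind (fun v => Rabs (Z v) > INR n) w * Rabs (Z w))) 0.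
Proof.
  intros hZ; apply e_cont.
  - intros n; apply (H_ind _ _ hH); [|apply (H_abs _ _ hH), hZ].
    apply (measurable_gt _ _ Finf_sigma), (H_meas _ _ hH), (H_abs _ _ hH), hZ.
  - intros n w; apply Rmult_le_compat_r; [apply Rabs_pos|].
    indcase (fun v => Rabs (Z v) > INR (S n)) w; [|apply ind_bounds].
    rewrite ind_true; [lra|]; rewrite S_INR in *; lra.
  - intros w eps heps; destruct (INR_unbounded (Rabs (Z w))) as [n hn]; exists n; intros m hm.
    assert (INR n <= INR m) by (apply le_INR; exact hm).
    rewrite ind_false by lra; unfold Rdist; rewrite Rmult_0_l, Rminus_diag, Rabs_R0; exact heps.
Qed.

(** Where [Rabs Z] is at most [n] the integrand is below [n * ind N], of expectation 0; the rest is
    controlled by [tail_integral_cv]. *)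
Lemma null_integral N Z : Finf Ft N -> V N = 0 -> H Z -> e (fun w => ind N w * Rabs (Z w)) <= 0.
Proof.
  intros hN h0 hZ; apply le_epsilon; intros eps heps.
  destruct (tail_integral_cv Z hZ eps heps) as [n hn].
  specialize (hn n (le_n n)); unfold Rdist in hn; rewrite Rminus_0_r in hn.
  set (B := fun v => Rabs (Z v) > INR n) in *.
  assert (hB : Finf Ft B)
    by apply (measurable_gt _ _ Finf_sigma), (H_meas _ _ hH), (H_abs _ _ hH), hZ.
  assert (hBZ : H (fun w => ind B w * Rabs (Z w)))
    by (apply (H_ind _ _ hH); [exact hB | apply (H_abs _ _ hH), hZ]).
  pose proof (Rle_abs (e (fun w => ind B w * Rabs (Z w)))).
  assert (e (fun w => ind N w * Rabs (Z w)) <=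
          e (fun w => INR n * ind N w) + e (fun w => ind B w * Rabs (Z w))).
  { eapply Rle_trans; [|apply e_add].
    - apply e_mono.
      + apply (H_ind _ _ hH); [exact hN | apply (H_abs _ _ hH), hZ].
      + apply (H_add _ _ hH); [apply (H_scal _ _ hH), H_indicator|]; auto.
      + intros w; pose proof (ind_bounds N w); pose proof (Rabs_pos (Z w)); pose proof (pos_INR n).
        indcase B w; [nra|]. assert (Rabs (Z w) <= INR n) by (apply Rnot_gt_le; auto). nra.
    - apply (H_scal _ _ hH), H_indicator; auto.
    - exact hBZ. }
  rewrite e_scal in * by (try apply H_indicator; auto; apply pos_INR).
  fold (V N) in *; rewrite h0 in *; lra.
Qed.

(** The approximable events form a sigma-algebra containing every [Ft t]. *)
Lemma Finf_approx A : Finf Ft A -> forall eta, 0 < eta ->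
  exists t B, Ft t B /\ V (fun w => ~ (A w <-> B w)) < eta.
Proof.
  pose proof Finf_sigma as hs.
  assert (hsd : forall A B, Finf Ft A -> Finf Ft B -> Finf Ft (fun w => ~ (A w <-> B w))).
  { intros A1 B1 h1 h2; apply sigma_not; auto.
    apply (sigma_ext _ _ (fun w => (A1 w /\ B1 w) \/ (~ A1 w /\ ~ B1 w))); [intros w; tauto|].
    apply sigma_or; auto; apply sigma_and; auto; apply sigma_not; auto. }
  (* Membership in [Finf] is carried along because [V_mono] and [V_or] require it. *)
  set (approx := fun A => Finf Ft A /\ forall eta, 0 < eta ->
    exists t B, Ft t B /\ V (fun w => ~ (A w <-> B w)) < eta).
  assert (hFa : forall t B, Ft t B -> approx B).
  { intros t B hB; split; [exact (Ft_Finf t B hB)|].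
    intros eta heta; exists t, B; split; auto.
    replace (fun w => ~ (B w <-> B w)) with (fun _ : Omega => False)
      by (apply pred_ext; intros w; tauto).
    unfold V; replace (ind (fun _ : Omega => False)) with (fun _ : Omega => 0)
      by (extensionality w; rewrite ind_false; tauto).
    rewrite e_const; exact heta. }
  assert (hor : forall A B, approx A -> approx B -> approx (fun w => A w \/ B w)).
  { intros A1 A2 [h1 h1'] [h2 h2']; split; [apply sigma_or; auto|].
    intros eta heta.
    destruct (h1' (eta / 2)) as [t1 [B1 [hB1 hV1]]]; [lra|].
    destruct (h2' (eta / 2)) as [t2 [B2 [hB2 hV2]]]; [lra|].
    assert (Ft (Nat.max t1 t2) (fun w => B1 w \/ B2 w)).
    { apply sigma_or; [apply Ft_sigma| |]; eapply Ft_mono; try eassumption; lia. }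
    exists (Nat.max t1 t2), (fun w => B1 w \/ B2 w); split; auto.
    pose proof (Ft_Finf _ _ hB1); pose proof (Ft_Finf _ _ hB2).
    eapply Rle_lt_trans; [|replace eta with (eta / 2 + eta / 2) by lra;
      apply Rplus_lt_compat; [exact hV1 | exact hV2]].
    eapply Rle_trans; [|apply V_or; auto].
    apply V_mono; [apply hsd; apply sigma_or; auto | apply sigma_or; auto|].
    intros w; tauto. }
  intros hA; apply (hA approx); [|intros B [t hB]; eapply hFa; eauto].
  split; [|split].
  - apply (hFa 0%nat), sigma_true, Ft_sigma.
  - intros A1 [h1 h1']; split; [apply sigma_not; auto|].
    intros eta heta; destruct (h1' eta heta) as [t [B [hB hV]]].
    exists t, (fun w => ~ B w); split; [apply sigma_not; auto; apply Ft_sigma|].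
    replace (fun w => ~ (~ A1 w <-> ~ B w)) with (fun w => ~ (A1 w <-> B w)); auto.
    apply pred_ext; intros w; tauto.
  (* Half of [eta] pays for cutting the countable union at a finite stage, half for approximating
     that finite union. *)
  - intros A1 hA1.
    assert (hU : forall n, approx (union_upto A1 n)).
    { induction n as [|n IH]; [rewrite union_upto_0 | rewrite union_upto_S]; auto. }
    assert (hA' : Finf Ft (fun w => exists n, A1 n w)) by (apply sigma_ex; auto; apply hA1).
    split; [exact hA'|].
    intros eta heta.
    destruct (V_union_tail A1 (eta / 2)) as [n hn]; [apply hA1 | lra|].
    destruct (hU n) as [hUn hUn'].
    destruct (hUn' (eta / 2)) as [t [B [hB hV]]]; [lra|].
    pose proof (Ft_Finf _ _ hB).
    assert (Finf Ft (fun w => (exists k, A1 k w) /\ ~ union_upto A1 n w))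
      by (apply sigma_and; auto; apply sigma_not; auto).
    exists t, B; split; auto.
    eapply Rle_lt_trans; [|replace eta with (eta / 2 + eta / 2) by lra;
      apply Rplus_lt_compat; [exact hn | exact hV]].
    eapply Rle_trans; [|apply V_or; auto].
    apply V_mono; [apply hsd | apply sigma_or|]; auto.
    intros w hw.
    assert (union_upto A1 n w -> exists n, A1 n w) by (intros [k [_ hk]]; exists k; exact hk).
    tauto.
Qed.

(** * Independence and conditional means *)

Lemma Ht_E t Z : H Z -> Ht Ft H t (E t Z).
Proof. apply (E_range _ _ _ hE). Qed.

(* Testing independence against [phi (z, y) = I(z = 1) (y - E X - c) + c]. *)
Lemma indep_test t X A c : H X -> indep_of_F Ft H E X t -> Ft t A ->
  e (fun w => ind A w * (E t (fun v => X v - e X) w - c) + c) =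
  e (fun w => ind A w * (- c) + c).
Proof.
  intros hX hI hA.
  pose proof (Ft_Finf _ _ hA) as hA'.
  assert (hY : H (fun w => X w - e X)) by (apply (H_shift X (- e X)), hX).
  assert (hYc : H (fun w => X w - e X - c)) by (apply (H_shift _ (- c)), hY).
  (* Using [ind (eq 1) z] as first factor makes joint measurability an instance of
     [measurable_ind_mult]; on values of an indicator it agrees with [z]. *)
  set (phi := fun z y => ind (eq 1) z * (y - e X - c) + c).
  assert (hphi1 : forall (A : Omega -> Prop) w, ind (eq 1) (ind A w) = ind A w).
  { intros B w; indcase B w; [apply ind_true | apply ind_false]; lra. }
  assert (hphiA : forall (A : Omega -> Prop) (Y : Omega -> R) w,
    phi (ind A w) (Y w) = ind A w * (Y w - e X - c) + c)
    by (intros; unfold phi; rewrite hphi1; reflexivity).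
  pose proof (gen_sigma_algebra (fun B : R * R -> Prop =>
    exists a b, forall p, B p <-> (fst p <= a /\ snd p <= b))) as hB2.
  assert (hphi : measurable2 phi).
  { apply (measurable_add _ _ hB2); [|apply (measurable_const _ _ hB2)].
    apply (measurable_ind_mult _ _ hB2 (fun p => 1 = fst p)).
    - apply (sigma_ext _ _ (fun p => fst p <= 1 /\ 1 <= fst p)); [intros p; lra|].
      apply (sigma_and _ _ hB2); [apply measurable_le | apply (measurable_ge _ _ hB2)];
        apply measurable_fst.
    - repeat apply (measurable_sub _ _ hB2); try apply measurable_snd;
        apply (measurable_const _ _ hB2). }
  assert (hH1 : H (fun w => ind A w * (X w - e X - c) + c))
    by (apply H_shift, (H_ind _ _ hH); auto).
  transitivity (e (fun w => phi (ind A w) (X w))).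
  (* Conditioning on [Ft t] inside [e] replaces [X - e X] by its conditional expectation. *)
  - replace (fun w => phi (ind A w) (X w)) with (fun w => ind A w * (X w - e X - c) + c)
      by (extensionality w; rewrite hphiA; reflexivity).
    rewrite <- (e_tower t (fun w => ind A w * (X w - e X - c) + c) hH1).
    f_equal; extensionality w.
    rewrite (E_translate t (fun w => ind A w * (X w - e X - c)) (fun _ => c) w);
      [|apply (H_ind _ _ hH); auto | apply Ht_const].
    rewrite (E_ind _ _ _ hE t A _ hA hYc).
    change (fun w => X w - e X - c) with (fun w => X w - e X + - c).
    rewrite (E_translate t (fun w => X w - e X) (fun _ => - c) w hY (Ht_const t (- c))).
    reflexivity.
  - unfold e at 1; rewrite (hI A hA phi hphi).
    + refine (f_equal e _); extensionality w.
      rewrite (E0_const (fun v => phi (ind A w) (X v))).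
      * replace (fun v => phi (ind A w) (X v)) with (fun v => ind A w * (X v - e X - c) + c)
          by (extensionality v; unfold phi; rewrite hphi1; reflexivity).
        rewrite e_shift by apply (H_scal _ _ hH), hYc.
        rewrite e_scal by (auto; apply ind_bounds).
        change (fun w => X w - e X - c) with (fun w => X w + - e X + - c).
        rewrite (e_shift (fun w => X w + - e X) (- c)) by apply H_shift, hX.
        rewrite e_shift by exact hX; f_equal; f_equal; lra.
      * apply H_shift, (H_scal _ _ hH), hYc.
    + replace (fun w => phi (ind A w) (X w)) with (fun w => ind A w * (X w - e X - c) + c)
        by (extensionality w; rewrite hphiA; reflexivity).
      exact hH1.
    + intros z; apply H_shift, (H_scal _ _ hH), hYc.
Qed.

(** The two signs of [U] need different tests. On [U >= 0] the test with [c = 0] gives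
    [e (ind A * U) = 0]. On [U < - eps] the test with [c = - eps] shows that this event is null.
    Elsewhere [Rabs U] is at most [eps]. *)
Lemma indep_cond_mean t X : H X -> indep_of_F Ft H E X t ->
  e (fun w => Rabs (E t (fun v => X v - e X) w)) <= 0.
Proof.
  intros hX hI; set (U := E t (fun v => X v - e X)).
  destruct (Ht_E t (fun v => X v - e X)) as [hU hUm]; [apply (H_shift X (- e X)), hX|].
  fold U in hU, hUm.
  apply le_epsilon; intros eps heps.
  set (A := fun w => 0 <= U w); set (B := fun w => U w < - eps).
  assert (hA : Ft t A) by (apply (measurable_ge _ _ (Ft_sigma t)), hUm).
  assert (hB : Ft t B) by (apply (measurable_lt _ _ (Ft_sigma t)), hUm).
  pose proof (Ft_Finf _ _ hA) as hA'; pose proof (Ft_Finf _ _ hB) as hB'.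
  assert (hAU : e (fun w => ind A w * U w) = 0).
  { pose proof (indep_test t X A 0 hX hI hA) as h; fold U in h.
    replace (fun w => ind A w * (U w - 0) + 0) with (fun w => ind A w * U w) in h
      by (extensionality w; lra).
    replace (fun w => ind A w * (- 0) + 0) with (fun _ : Omega => 0) in h
      by (extensionality w; lra).
    rewrite h; apply e_const. }
  assert (hVB : V B = 0).
  { apply Rle_antisym; [|apply V_nonneg, hB'].
    (* The integrand on the left is at most [- eps] everywhere, while the right side equals
       [eps * V B - eps]; hence [V B <= 0]. *)
    pose proof (indep_test t X B (- eps) hX hI hB) as h; fold U in h.
    replace (fun w => ind B w * (- - eps) + - eps) with (fun w => eps * ind B w + - eps) in h
      by (extensionality w; lra).
    rewrite (e_shift (fun w => eps * ind B w)) in h by apply (H_scal _ _ hH), H_indicator, hB'.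
    rewrite e_scal in h by (try apply H_indicator; auto; lra); fold (V B) in h.
    assert (h' : e (fun w => ind B w * (U w - - eps) + - eps) <= e (fun _ => - eps)).
    { apply e_mono.
      - apply H_shift, (H_ind _ _ hH); auto; apply (H_shift U (- - eps)), hU.
      - apply (H_const _ _ hH).
      - intros w; indcase B w; unfold B in *; lra. }
    rewrite e_const in h'; nra. }
  pose proof (null_integral B U hB' hVB hU) as hBU.
  assert (hH1 : H (fun w => ind A w * U w)) by (apply (H_ind _ _ hH); auto).
  assert (hH2 : H (fun w => ind B w * Rabs (U w)))
    by (apply (H_ind _ _ hH); auto; apply (H_abs _ _ hH), hU).
  assert (e (fun w => Rabs (U w)) <= e (fun w => ind A w * U w + ind B w * Rabs (U w) + eps)).
  { apply e_mono.
    - apply (H_abs _ _ hH), hU.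
    - apply H_shift, (H_add _ _ hH); auto.
    - intros w; unfold Rabs; indcase A w; indcase B w; unfold A, B in *;
        destruct Rcase_abs; lra. }
  rewrite e_shift in * by (apply (H_add _ _ hH); auto).
  pose proof (e_add _ _ hH1 hH2); lra.
Qed.

(* A predictable integral against [X - e X] cannot lower [e], whatever the sign of the integrand. *)
Lemma e_predictable_integral t X Z x K : H X -> indep_of_F Ft H E X t ->
  Ht Ft H t Z -> Ht Ft H t x -> (forall w, Rabs (x w) <= K) -> 0 <= K ->
  H (fun w => x w * (X w - e X)) ->
  e Z <= e (fun w => Z w - x w * (X w - e X)).
Proof.
  intros hX hI hZ hx hK hK0 hxY.
  set (Y := fun w => X w - e X).
  change (H (fun w => x w * Y w)) in hxY; change (e Z <= e (fun w => Z w - x w * Y w)).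
  assert (hY : H Y) by (apply (H_shift X (- e X)), hX).
  destruct (Ht_E t Y hY) as [hU hUm].
  pose proof (indep_cond_mean t X hX hI) as h0; fold Y in h0.
  assert (hlam : Ht Ft H t (fun w => - x w)).
  { split; [apply H_opp, hx|].
    replace (fun w => - x w) with (fun w => -1 * x w) by (extensionality w; lra).
    apply (measurable_scal _ _ (Ft_sigma t)), hx. }
  assert (hlY : H (fun w => - x w * Y w)).
  { replace (fun w => - x w * Y w) with (fun w => - (x w * Y w)) by (extensionality w; lra).
    apply H_opp, hxY. }
  replace (fun w => Z w - x w * Y w) with (fun w => - x w * Y w + Z w)
    by (extensionality w; lra).
  rewrite <- (e_tower t (fun w => - x w * Y w + Z w)) by (apply (H_add _ _ hH); auto; apply hZ).
  assert (hKU : H (fun w => K * Rabs (E t Y w)))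
    by apply (H_scal _ _ hH), (H_abs _ _ hH), hU.
  apply Rle_trans with (e (fun w => Z w - K * Rabs (E t Y w))).
  - pose proof (e_sub Z _ (proj1 hZ) hKU) as h.
    rewrite e_scal in h by (auto; apply (H_abs _ _ hH), hU); nra.
  - apply e_mono.
    + apply H_sub; auto; apply hZ.
    + apply (E_range _ _ _ hE), (H_add _ _ hH); auto; apply hZ.
    + intros w; rewrite (E_translate t (fun w => - x w * Y w) Z w hlY hZ).
      rewrite (E_posh _ _ _ hE t (fun w => - x w) Y hlam hY hlY).
      (* This gives [u + u' >= 0]. For positive [x] the conditional expectation of [- x * Y] is
         [x * u'], at least [- x * u]; for negative [x] it is [- x * u]. Both are at least
         [- K * Rabs u]. *)
      pose proof (E_subadd _ _ _ hE t Y (fun w => - Y w) hY (H_opp _ hY) w) as h.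
      cbv beta in h.
      replace (fun w => Y w + - Y w) with (fun _ : Omega => 0) in h by (extensionality v; lra).
      rewrite (E_id _ _ _ hE t _ (Ht_const t 0)) in h.
      specialize (hK w); set (u := E t Y w) in *; set (u' := E t (fun w => - Y w) w) in *.
      unfold Rmax, Rabs in *; repeat destruct Rle_dec; repeat destruct Rcase_abs; nra.
Qed.

(** * Finitely valued approximation *)

Lemma bounded_nat_function t (f : Omega -> nat) (N : nat) :
  (forall k : nat, Ft t (fun w => (k <= f w)%nat)) ->
  measurable (Ft t) (fun w => INR (Nat.min (f w) N)) /\
  forall Y, H Y -> H (fun w => INR (Nat.min (f w) N) * Y w).
Proof.
  intros hf; induction N as [|N [IH1 IH2]].
  - split.
    + replace (fun w => INR (Nat.min (f w) 0)) with (fun _ : Omega => 0)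
        by (extensionality w; rewrite Nat.min_0_r; reflexivity).
      apply measurable_const, Ft_sigma.
    + intros Y _.
      replace (fun w => INR (Nat.min (f w) 0) * Y w) with (fun _ : Omega => 0)
        by (extensionality w; rewrite Nat.min_0_r; simpl; lra).
      apply (H_const _ _ hH).
  - set (A := fun w => (S N <= f w)%nat).
    (* Raising the cap by one adds a single indicator, whose product with [Y] is in [H] by
       [H_ind]. *)
    assert (heq : forall w, INR (Nat.min (f w) (S N)) = INR (Nat.min (f w) N) + ind A w).
    { intros w; indcase A w; unfold A in *.
      - rewrite !Nat.min_r by lia; apply S_INR.
      - rewrite !Nat.min_l by lia; lra. }
    split.
    + replace (fun w => INR (Nat.min (f w) (S N)))
        with (fun w => INR (Nat.min (f w) N) + ind A w)
        by (extensionality w; rewrite heq; reflexivity).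
      apply (measurable_add _ _ (Ft_sigma t)); [exact IH1|].
      apply (measurable_ind _ _ (Ft_sigma t)), hf.
    + intros Y hY.
      replace (fun w => INR (Nat.min (f w) (S N)) * Y w)
        with (fun w => INR (Nat.min (f w) N) * Y w + ind A w * Y w)
        by (extensionality w; rewrite heq; lra).
      apply (H_add _ _ hH); [apply IH2, hY|].
      apply (H_ind _ _ hH); [apply (Ft_Finf t), hf | exact hY].
Qed.

(* [H] need not contain all bounded measurable functions, but it contains the finitely valued ones. *)
Lemma discretize t W K eta : measurable (Ft t) W -> (forall w, - K <= W w <= K) -> 0 < eta ->
  exists Z, measurable (Ft t) Z /\ (forall w, W w - eta <= Z w <= W w) /\
    (forall Y, H Y -> H (fun w => Z w * Y w)).
Proof.
  intros hW hK heta; pose proof (Ft_sigma t) as hs.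
  (* [r] measures the height of [W] above [- K] in units of [eta]; rounding it down to the integer
     [f] loses at most [eta] in [W]. *)
  set (r := fun w => (W w + K) / eta).
  assert (hr : forall w, W w = eta * r w - K) by (intros w; unfold r; field; lra).
  assert (hr0 : forall w, 0 <= r w).
  { intros w; specialize (hK w).
    apply Rmult_le_pos; [lra | apply Rlt_le, Rinv_0_lt_compat, heta]. }
  set (f := fun w => Z.to_nat (Int_part (r w))).
  assert (hf : forall w, INR (f w) <= r w < INR (f w) + 1).
  { intros w; destruct (base_Int_part (r w)) as [h1 h2]; specialize (hr0 w).
    assert (-1 < Int_part (r w))%Z by (apply lt_IZR; lra).
    unfold f; rewrite INR_IZR_INZ, Z2Nat.id by lia; lra. }
  destruct (INR_unbounded (2 * K / eta)) as [N hN].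
  assert (hfN : forall w, (f w <= N)%nat).
  { intros w; apply INR_le; specialize (hf w); specialize (hK w).
    assert (r w <= 2 * K / eta); [|lra].
    apply Rmult_le_compat_r; [apply Rlt_le, Rinv_0_lt_compat, heta | lra]. }
  destruct (bounded_nat_function t f N) as [h1 h2].
  { intros k; apply (sigma_ext _ _ (fun w => eta * INR k - K <= W w)).
    - intros w; specialize (hf w); rewrite hr; split; intros h.
      + assert (INR k <= r w) by nra.
        apply Nat.lt_succ_r, INR_lt; rewrite S_INR; lra.
      + apply le_INR in h; nra.
    - apply (measurable_ge _ _ hs), hW. }
  (* As [f w <= N], the cap preserves the value of [f] and brings it under
     [bounded_nat_function]. *)
  exists (fun w => eta * INR (Nat.min (f w) N) - K); split; [|split].
  - apply (measurable_sub _ _ hs); [apply (measurable_scal _ _ hs), h1|].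
    apply (measurable_const _ _ hs).
  - intros w; rewrite Nat.min_l by apply hfN; specialize (hf w); rewrite hr; nra.
  - intros Y hY.
    replace (fun w => (eta * INR (Nat.min (f w) N) - K) * Y w)
      with (fun w => eta * (INR (Nat.min (f w) N) * Y w) - K * Y w) by (extensionality w; lra).
    apply H_sub; apply (H_scal _ _ hH); auto.
Qed.

Lemma discretize_Ht t W K eta : measurable (Ft t) W -> (forall w, - K <= W w <= K) -> 0 < eta ->
  exists Z, Ht Ft H t Z /\ (forall w, W w - eta <= Z w <= W w).
Proof.
  intros hW hK heta; destruct (discretize t W K eta hW hK heta) as [Z [h1 [h2 h3]]].
  exists Z; split; [|exact h2]; split; [|exact h1].
  replace Z with (fun w => Z w * 1) by (extensionality w; lra).
  apply h3, (H_const _ _ hH).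
Qed.

(** * Kolmogorov's inequality *)

(* [H] need not contain [Y^2], so [Q] is linear for large [Y] and finitely valued otherwise;
   the last conjunct is how [Q] replaces [Y^2] in [eps^2 - (x + Y)^2]. *)
Lemma truncated_square t Y eps eta : Ht Ft H t Y -> 0 < eps -> 0 < eta ->
  exists Q, Ht Ft H t Q /\ (forall w, 0 <= Q w <= Y w ^ 2) /\
    forall w x, Rabs x <= eps ->
      let lower := eps ^ 2 - x ^ 2 - 2 * x * Y w - Q w - eta in
      (Rabs (x + Y w) <= eps -> lower <= eps ^ 2 - (x + Y w) ^ 2) /\
      (~ Rabs (x + Y w) <= eps -> lower <= 0).
Proof.
  intros [hY hYm] heps heta; pose proof (Ft_sigma t) as hs.
  (* Beyond [3 * eps], a sum [x + Y] with [Rabs x <= eps] exceeds [eps] in absolute value, and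
     [2 * eps * Rabs Y + eps ^ 2] is at most [Y ^ 2], so the linear [Ylin] can serve as [Q]
     there. *)
  set (A := fun w => Rabs (Y w) <= 3 * eps).
  assert (hA : Ft t A) by apply (measurable_le _ (Ft t)), (measurable_abs _ _ hs), hYm.
  destruct (discretize_Ht t (fun w => ind A w * (Y w * Y w)) (9 * eps ^ 2) eta)
    as [D [[hD hDm] hDb]]; [|intros w|exact heta|].
  { apply (measurable_ind_mult _ _ hs); auto; apply (measurable_sqr _ _ hs), hYm. }
  { indcase A w; unfold A, Rabs in *; [destruct Rcase_abs|]; nra. }
  (* [D] may dip to [- eta]. Replacing its negative values by 0 makes [Q] nonnegative and keeps
     [Y ^ 2 - eta <= Q], since there [Y ^ 2 - eta <= D < 0]. *)
  set (C := fun w => A w /\ 0 <= D w).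
  assert (hC : Ft t C).
  { apply (sigma_and _ _ hs); auto; apply (measurable_ge _ _ hs), hDm. }
  assert (hnA : Ft t (fun w => ~ A w)) by (apply (sigma_not _ _ hs), hA).
  set (Ylin := fun w => 2 * eps * Rabs (Y w) + eps ^ 2).
  set (Q := fun w => ind C w * D w + ind (fun v => ~ A v) w * Ylin w).
  assert (hQ : forall w, (A w -> 0 <= Q w <= Y w ^ 2 /\ Y w ^ 2 - eta <= Q w) /\
                         (~ A w -> Q w = Ylin w)).
  { intros w; specialize (hDb w); unfold Q; split; intros hw.
    - rewrite (ind_false (fun v => ~ A v)) by tauto; rewrite ind_true in hDb by auto.
      indcase C w; [unfold C in *; nra|].
      assert (D w < 0) by (apply Rnot_le_lt; intros h'; apply h; split; auto); nra.
    - rewrite (ind_true (fun v => ~ A v)) by tauto; rewrite (ind_false C); [lra|].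
      unfold C; tauto. }
  exists Q; split; [|split].
  - split.
    + apply (H_add _ _ hH).
      * apply (H_ind _ _ hH); auto; apply (Ft_Finf t), hC.
      * apply (H_ind _ _ hH); [apply (Ft_Finf t), hnA|].
        apply H_shift, (H_scal _ _ hH), (H_abs _ _ hH), hY.
    + apply (measurable_add _ _ hs); apply (measurable_ind_mult _ _ hs); auto.
      apply (measurable_add _ _ hs); [|apply (measurable_const _ _ hs)].
      apply (measurable_scal _ _ hs), (measurable_abs _ _ hs), hYm.
  - intros w; destruct (hQ w) as [h1 h2]; destruct (classic (A w)) as [h | h].
    + apply h1, h.
    + rewrite h2 by exact h; unfold Ylin, A, Rabs in *; destruct Rcase_abs; nra.
  - intros w x hx lower; destruct (hQ w) as [h1 h2]; unfold lower; clear lower.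
    destruct (classic (A w)) as [h | h].
    + destruct (h1 h) as [_ h3]; split; intros h4; [nra|].
      assert (eps < Rabs (x + Y w)) by lra.
      assert (eps ^ 2 < (x + Y w) ^ 2) by (rewrite <- (pow2_abs (x + Y w)); nra).
      nra.
    + rewrite h2 by exact h; unfold Ylin, A in *.
      assert (hxy : - (2 * x * Y w) <= 2 * eps * Rabs (Y w)).
      { pose proof (Rle_abs (- (x * Y w))) as hle; rewrite Rabs_Ropp, Rabs_mult in hle.
        pose proof (Rabs_pos (Y w)); nra. }
      split; intros h4; [|nra].
      exfalso; pose proof (Rabs_triang_inv (Y w) (- x)) as h5.
      rewrite Rabs_Ropp in h5; replace (Y w - - x) with (x + Y w) in h5 by lra; lra.
Qed.

(** In [eps^2 - (M + Y)^2 = (eps^2 - M^2) - 2MY - Y^2] the cross term cannot lower [e] by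
    [e_predictable_integral], and [Q] stands for the square. Points that exit contribute at most 0.
    A minorant [Z] in [H] is propagated because the squares themselves may lie outside [H]. *)
Lemma kolmogorov_step t X M G Z Q eps eta : Ht Ft H (S t) X -> indep_of_F Ft H E X t ->
  measurable (Ft t) M -> Ft t G -> (forall w, G w -> Rabs (M w) <= eps) -> 0 < eps -> 0 < eta ->
  Ht Ft H (S t) Q -> (forall w, 0 <= Q w) ->
  (forall w x, Rabs x <= eps ->
      let lower := eps ^ 2 - x ^ 2 - 2 * x * (X w - e X) - Q w - eta in
      (Rabs (x + (X w - e X)) <= eps -> lower <= eps ^ 2 - (x + (X w - e X)) ^ 2) /\
      (~ Rabs (x + (X w - e X)) <= eps -> lower <= 0)) ->
  Ht Ft H t Z -> (forall w, Z w <= ind G w * (eps ^ 2 - M w ^ 2)) ->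
  exists Z', Ht Ft H (S t) Z' /\
    (forall w, Z' w <= ind (fun v => G v /\ Rabs (M v + (X v - e X)) <= eps) w *
                       (eps ^ 2 - (M w + (X w - e X)) ^ 2)) /\
    e Z - (e Q + 2 * eta) <= e Z'.
Proof.
  intros [hX hXm] hI hM hG hGM heps heta [hQ hQm] hQ0 hlow hZ hZG.
  pose proof (Ft_sigma t) as hs; pose proof (Ft_sigma (S t)) as hs'.
  set (Y := fun w => X w - e X).
  assert (hY : H Y) by (apply (H_shift X (- e X)), hX).
  assert (hYm : measurable (Ft (S t)) Y)
    by (apply (measurable_sub _ _ hs'); auto; apply (measurable_const _ _ hs')).
  assert (hYa : H (fun w => Rabs (Y w))) by apply (H_abs _ _ hH), hY.
  assert (ha0 : 0 <= e (fun w => Rabs (Y w))) by (apply e_nonneg; auto; intros; apply Rabs_pos).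
  set (a := e (fun w => Rabs (Y w))) in *.
  (* With mesh [s] the discretization costs at most [s * a <= eta] in expectation; the [1 +] covers
     [a = 0]. *)
  set (s := eta / (1 + a)).
  assert (hs0 : 0 < s) by (apply Rdiv_lt_0_compat; lra).
  assert (hsa : s * a <= eta).
  { assert (s * (1 + a) = eta) by (unfold s; field; lra); nra. }
  (* The integrand [2 * M] on [G] is discretized so that its product with [Y] is in [H]. *)
  destruct (discretize t (fun w => ind G w * (2 * M w)) (2 * eps) s) as [x [hxm [hxb hxH]]];
    [|intros w|exact hs0|].
  { apply (measurable_ind_mult _ _ hs), (measurable_scal _ _ hs); auto. }
  { indcase G w; [|lra]; specialize (hGM w h); unfold Rabs in *; destruct Rcase_abs; lra. }
  assert (hx : H x).
  { replace x with (fun w => x w * 1) by (extensionality w; lra).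
    apply hxH, (H_const _ _ hH). }
  assert (hxK : forall w, Rabs (x w) <= 2 * eps + s).
  { intros w; specialize (hxb w); apply Rabs_le; revert hxb.
    indcase G w; [|lra]; specialize (hGM w h); unfold Rabs in *; destruct Rcase_abs; lra. }
  assert (hxY : H (fun w => x w * Y w)) by (apply hxH, hY).
  pose proof (e_predictable_integral t X Z x (2 * eps + s) hX hI hZ (conj hx hxm) hxK
    ltac:(lra) hxY) as hpred.
  change (e Z <= e (fun w => Z w - x w * Y w)) in hpred.
  (* The three losses: the square, the discretization error, and the slack in [lower]. Their
     expectation is at most [e Q + 2 * eta]. *)
  set (L := fun w => Q w + s * Rabs (Y w) + eta).
  assert (hL : H L) by (apply H_shift, (H_add _ _ hH); auto; apply (H_scal _ _ hH), hYa).
  assert (hZx : H (fun w => Z w - x w * Y w)) by (apply H_sub; auto; apply hZ).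
  exists (fun w => Z w - x w * Y w - L w); split; [|split].
  - split; [apply H_sub; auto|].
    assert (hup : forall W, measurable (Ft t) W -> measurable (Ft (S t)) W).
    { intros W hW; apply (measurable_le_intro _ _ hs'); intros c.
      apply (Ft_mono t); [lia | apply measurable_le, hW]. }
    assert (measurable (Ft (S t)) (fun w => x w * Y w)).
    (* Polarization. *)
    { replace (fun w => x w * Y w) with
        (fun w => / 4 * ((x w + Y w) * (x w + Y w) - (x w - Y w) * (x w - Y w)))
        by (extensionality w; field).
      apply (measurable_scal _ _ hs'), (measurable_sub _ _ hs');
        apply (measurable_sqr _ _ hs');
        [apply (measurable_add _ _ hs') | apply (measurable_sub _ _ hs')]; auto. }
    apply (measurable_sub _ _ hs'); [apply (measurable_sub _ _ hs'); auto; apply hup, hZ|].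
    repeat apply (measurable_add _ _ hs'); auto; [|apply (measurable_const _ _ hs')].
    apply (measurable_scal _ _ hs'), (measurable_abs _ _ hs'), hYm.
  - intros w; specialize (hZG w); specialize (hxb w); specialize (hQ0 w).
    change (X w - e X) with (Y w); pose proof (Rle_abs (Y w)) as hy1.
    pose proof (Rle_abs (- Y w)) as hy2; rewrite Rabs_Ropp in hy2; unfold L.
    indcase G w.
    + rewrite ind_true in hZG, hxb by exact h.
      destruct (hlow w (M w) (hGM w h)) as [h1 h2].
      change (X w - e X) with (Y w) in h1, h2.
      assert (- (x w * Y w) <= - (2 * M w * Y w) + s * Rabs (Y w)) by nra.
      destruct (classic (Rabs (M w + Y w) <= eps)) as [h3 | h3].
      * rewrite ind_true by (split; auto); specialize (h1 h3); lra.
      * rewrite ind_false by (intros [_ h4]; auto); specialize (h2 h3); lra.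
    + rewrite ind_false in hZG, hxb by exact h.
      rewrite ind_false by (intros [h1 _]; auto).
      assert (- (x w * Y w) <= s * Rabs (Y w)) by nra.
      lra.
  - pose proof (e_sub _ L hZx hL) as h1; cbv beta in h1.
    assert (h2 : e L <= e Q + s * a + eta).
    { unfold L; rewrite (e_shift (fun w => Q w + s * Rabs (Y w)))
        by (apply (H_add _ _ hH); auto; apply (H_scal _ _ hH), hYa).
      unfold a; rewrite <- e_scal by (auto; lra).
      apply Rplus_le_compat_r, e_add; auto; apply (H_scal _ _ hH), hYa. }
    lra.
Qed.

(** The sum covers the indices 1 to [n], so that partial sums at [n] are known at time [n];
    [sum_f_R0] of the shifted sequence up to [n] is [psum] at [S n]. *)
Fixpoint psum (f : nat -> R) (n : nat) : R :=
  match n with O => 0 | S k => psum f k + f (S k) end.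

Lemma psum_sum_f_R0 f n : psum f (S n) = sum_f_R0 (fun k => f (S k)) n.
Proof. induction n as [|n IH]; [simpl; lra|]. simpl sum_f_R0; rewrite <- IH; reflexivity. Qed.

Lemma psum_add f g n : psum (fun i => f i + g i) n = psum f n + psum g n.
Proof. induction n as [|n IH]; simpl; lra. Qed.

Lemma psum_scal c f n : psum (fun i => c * f i) n = c * psum f n.
Proof. induction n as [|n IH]; simpl; [|rewrite IH]; lra. Qed.

Lemma psum_half n : psum (pow (1 / 2)) n <= 1.
Proof.
  assert (h : psum (pow (1 / 2)) n = 1 - (1 / 2) ^ n).
  { induction n as [|n IH]; simpl in *; lra. }
  rewrite h; pose proof (pow_lt (1 / 2) n); lra.
Qed.

(** * Oscillation of the partial sums *)

Section Series.
Variable X : nat -> Omega -> R.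
Hypothesis hX : forall i, Ht Ft H (S i) (X (S i)) /\ indep_of_F Ft H E (X (S i)) i.

Let Y (i : nat) (w : Omega) : R := X i w - e (X i).
Let W (n : nat) (w : Omega) : R := psum (fun i => Y i w) n.

Lemma measurable_partial_sum n t : (n <= t)%nat -> measurable (Ft t) (W n).
Proof.
  intros hnt; pose proof (Ft_sigma t) as hs; induction n as [|n IH].
  - apply (measurable_const _ _ hs).
  - apply (measurable_add _ _ hs); [apply IH; lia|].
    apply (measurable_sub _ _ hs); [|apply (measurable_const _ _ hs)].
    apply (measurable_le_intro _ _ hs); intros c.
    apply (Ft_mono (S n)); [exact hnt | apply measurable_le, hX].
Qed.

(** Counting steps after [m] lets inductions on [n] start from an event that always holds. *)
Definition stays (eps : R) (m n : nat) (w : Omega) : Prop :=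
  forall k, (k <= n)%nat -> Rabs (W (k + m) w - W m w) <= eps.

Lemma Ft_stays eps m n : Ft (n + m) (stays eps m n).
Proof.
  pose proof (Ft_sigma (n + m)) as hs.
  apply (sigma_all _ _ hs (fun k w => (k <= n)%nat -> Rabs (W (k + m) w - W m w) <= eps)).
  intros k; destruct (classic (k <= n)%nat) as [hk | hk].
  - apply (sigma_ext _ _ (fun w => Rabs (W (k + m) w - W m w) <= eps)); [tauto|].
    apply (measurable_le _ (Ft (n + m))), (measurable_abs _ _ hs).
    apply (measurable_sub _ _ hs); apply measurable_partial_sum; lia.
  - apply (sigma_ext _ _ (fun _ => True)); [tauto | apply (sigma_true _ _ hs)].
Qed.

Lemma stays_S eps m n w :
  stays eps m (S n) w <-> stays eps m n w /\ Rabs (W (n + m) w - W m w + Y (S n + m) w) <= eps.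
Proof.
  assert (heq : W (S n + m) w - W m w = W (n + m) w - W m w + Y (S n + m) w)
    by (unfold W; simpl; lra).
  rewrite <- heq; split.
  - intros h; split; [intros k hk|]; apply h; lia.
  - intros [h1 h2] k hk; destruct (Nat.eq_dec k (S n)) as [-> | hne]; auto; apply h1; lia.
Qed.

(** [Q] and [eta] abstract what [truncated_square] supplies at each index. *)
Variables (eps : R) (eta : nat -> R) (Q : nat -> Omega -> R).
Hypotheses (heps : 0 < eps) (heta : forall i, 0 < eta i).
Hypothesis hQ : forall i, Ht Ft H (S i) (Q (S i)) /\ (forall w, 0 <= Q (S i) w) /\
  forall w x, Rabs x <= eps ->
    let lower := eps ^ 2 - x ^ 2 - 2 * x * Y (S i) w - Q (S i) w - eta (S i) in
    (Rabs (x + Y (S i) w) <= eps -> lower <= eps ^ 2 - (x + Y (S i) w) ^ 2) /\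
    (~ Rabs (x + Y (S i) w) <= eps -> lower <= 0).

(** The accumulated losses of [kolmogorov_step]. *)
Let A (n : nat) : R := psum (fun i => e (Q i) + 2 * eta i) n.

(** The iteration starts from [eps ^ 2 * ind B], where the increment of [W] is 0; each step costs
    one increment of [A]. *)
Lemma kolmogorov_iterate m B n : Ft m B ->
  exists Z, Ht Ft H (n + m) Z /\
    (forall w, Z w <= ind (fun v => B v /\ stays eps m n v) w * (eps ^ 2 - (W (n + m) w - W m w) ^ 2)) /\
    eps ^ 2 * V B - (A (n + m) - A m) <= e Z.
Proof.
  intros hB; induction n as [|n [Z [hZ [hZle hZe]]]].
  - pose proof (Ft_Finf _ _ hB) as hB'.
    exists (fun w => eps ^ 2 * ind B w); split; [|split].
    + split; [apply (H_scal _ _ hH), H_indicator, hB'|].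
      apply (measurable_scal _ _ (Ft_sigma m)), (measurable_ind _ _ (Ft_sigma m)), hB.
    + intros w; simpl plus; indcase B w.
      * rewrite ind_true; [nra|]; split; [exact h|]; intros k hk.
        replace k with O by lia; simpl plus; rewrite Rminus_diag, Rabs_R0; lra.
      * rewrite ind_false by tauto; lra.
    + rewrite e_scal by (try apply H_indicator; auto; apply pow2_ge_0); fold (V B); simpl plus; lra.
  - destruct (hX (n + m)) as [hX1 hX2]; destruct (hQ (n + m)) as [hQ1 [hQ2 hQ3]].
    assert (hB' : Ft (n + m) B) by (apply (Ft_mono m); [lia | exact hB]).
    destruct (kolmogorov_step (n + m) (X (S (n + m))) (fun w => W (n + m) w - W m w)
      (fun v => B v /\ stays eps m n v) Z (Q (S (n + m))) eps (eta (S (n + m))))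
      as [Z' [h1 [h2 h3]]]; auto.
    + apply (measurable_sub _ _ (Ft_sigma (n + m))); apply measurable_partial_sum; lia.
    + apply (sigma_and _ _ (Ft_sigma (n + m))); [exact hB' | apply Ft_stays].
    + intros w [_ h]; apply h; lia.
    + exists Z'; split; [exact h1|]; split.
      * intros w; specialize (h2 w).
        replace (fun v => B v /\ stays eps m (S n) v) with
          (fun v => (B v /\ stays eps m n v) /\
            Rabs (W (n + m) v - W m v + (X (S (n + m)) v - e (X (S (n + m))))) <= eps).
        { replace (W (S n + m) w - W m w)
            with (W (n + m) w - W m w + (X (S (n + m)) w - e (X (S (n + m)))))
            by (unfold W, Y; simpl; lra).
          exact h2. }
        apply pred_ext; intros v; rewrite stays_S; unfold Y; simpl plus; tauto.
      * replace (A (S n + m)) with (A (n + m) + (e (Q (S (n + m))) + 2 * eta (S (n + m))))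
          by reflexivity.
        lra.
Qed.

(** The minorant from [kolmogorov_iterate] is at most [eps ^ 2] times the indicator of the event. *)
Lemma V_stays m B n : Ft m B ->
  eps ^ 2 * V B - (A (n + m) - A m) <= eps ^ 2 * V (fun v => B v /\ stays eps m n v).
Proof.
  intros hB; destruct (kolmogorov_iterate m B n hB) as [Z [[hZ _] [hZle hZe]]].
  assert (hG : Finf Ft (fun v => B v /\ stays eps m n v)).
  { apply (sigma_and _ _ Finf_sigma); [apply (Ft_Finf m), hB | apply (Ft_Finf (n + m)), Ft_stays]. }
  unfold V at 2; rewrite <- e_scal by (try apply H_indicator; auto; apply pow2_ge_0).
  eapply Rle_trans; [exact hZe|]; apply e_mono; auto.
  - apply (H_scal _ _ hH), H_indicator, hG.
  - intros w; eapply Rle_trans; [apply hZle|].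
    pose proof (ind_bounds (fun v => B v /\ stays eps m n v) w).
    pose proof (pow2_ge_0 (W (n + m) w - W m w)); nra.
Qed.

Lemma Finf_stays m : Finf Ft (fun v => forall n, stays eps m n v).
Proof.
  apply (sigma_all _ _ Finf_sigma (fun n v => stays eps m n v)); intros n.
  apply (Ft_Finf (n + m)), Ft_stays.
Qed.

(** The limit in [n] reduces to continuity at the empty set: [D n], the paths that stay for [n]
    steps but leave later, decreases to nothing, and subadditivity absorbs it. *)
Lemma V_stays_forever m B Sb : Ft m B -> (forall n, A n <= Sb) ->
  eps ^ 2 * V B - (Sb - A m) <= eps ^ 2 * V (fun v => B v /\ forall n, stays eps m n v).
Proof.
  intros hB hA; pose proof Finf_sigma as hs; pose proof (Ft_Finf _ _ hB) as hB'.
  pose proof (Finf_stays m) as hinf.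
  assert (hst : forall n, Finf Ft (stays eps m n))
    by (intros n; apply (Ft_Finf (n + m)), Ft_stays).
  set (D := fun n v => stays eps m n v /\ ~ forall k, stays eps m k v).
  assert (hD : forall n, Finf Ft (D n))
    by (intros n; apply (sigma_and _ _ hs); auto; apply (sigma_not _ _ hs), hinf).
  assert (hc : Un_cv (fun n => V (D n)) 0).
  { apply V_cont; auto.
    - intros n w [h1 h2]; split; auto; apply stays_S, h1.
    - intros w; destruct (classic (forall k, stays eps m k w)) as [h | h].
      + exists O; intros [_ h']; auto.
      + apply not_all_ex_not in h; destruct h as [n hn]; exists n; intros [h' _]; auto. }
  set (G := fun v => B v /\ forall n, stays eps m n v).
  assert (hG : Finf Ft G) by (apply (sigma_and _ _ hs); auto).
  apply le_epsilon; intros d hd.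
  destruct (hc (d / eps ^ 2)) as [n hn]; [apply Rdiv_lt_0_compat; nra|].
  specialize (hn n (le_n n)); unfold Rdist in hn; rewrite Rminus_0_r in hn.
  pose proof (Rle_abs (V (D n))) as hn'; pose proof (V_stays m B n hB) as h1.
  assert (h2 : V (fun v => B v /\ stays eps m n v) <= V G + V (D n)).
  { eapply Rle_trans; [|apply V_or; auto].
    apply V_mono; [apply (sigma_and _ _ hs); auto | apply (sigma_or _ _ hs); auto|].
    intros w; unfold G, D; tauto. }
  assert (h3 : eps ^ 2 * (d / eps ^ 2) = d) by (field; lra).
  specialize (hA (n + m)%nat); nra.
Qed.

Lemma oscillation_null : (exists Sb, forall n, A n <= Sb) ->
  Finf Ft (fun v => forall m, ~ forall n, stays eps m n v) /\
  V (fun v => forall m, ~ forall n, stays eps m n v) = 0.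
Proof.
  intros [Sb hSb]; pose proof Finf_sigma as hs.
  set (osc := fun v => forall m, ~ forall n, stays eps m n v).
  assert (hosc : Finf Ft osc).
  { apply (sigma_all _ _ hs (fun m v => ~ forall n, stays eps m n v)); intros m.
    apply (sigma_not _ _ hs), Finf_stays. }
  split; [exact hosc|].
  assert (hAgrow : Un_growing A).
  { intros n; unfold A; simpl.
    assert (0 <= e (Q (S n))) by (apply e_nonneg; apply hQ).
    specialize (heta (S n)); lra. }
  (* The limit [L] replaces the bound [Sb] so that the remaining loss [L - A m] tends to 0. *)
  destruct (Un_cv_crit A hAgrow) as [L hL]; [exists Sb; intros x [n ->]; apply hSb|].
  assert (hAL : forall n, A n <= L) by (intros n; apply growing_ineq; auto).
  apply Rle_antisym; [|apply V_nonneg, hosc].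
  apply le_epsilon; intros d hd.
  destruct (Finf_approx osc hosc (d / 4)) as [t [B [hB hBV]]]; [lra|].
  pose proof (Ft_Finf _ _ hB) as hB'.
  set (sd := fun w => ~ (osc w <-> B w)) in *.
  assert (hsd : Finf Ft sd).
  { apply (sigma_ext _ _ (fun w => (osc w /\ ~ B w) \/ (B w /\ ~ osc w))).
    - intros w; unfold sd; tauto.
    - apply (sigma_or _ _ hs); apply (sigma_and _ _ hs); auto; apply (sigma_not _ _ hs); auto. }
  (* After division by [eps ^ 2] this loss contributes [d / 4] to [V B], and [V sd] another
     [d / 4]. *)
  destruct (hL (eps ^ 2 * (d / 4))) as [n0 hn0]; [apply Rmult_lt_0_compat; [apply pow_lt, heps | lra]|].
  set (m := Nat.max n0 t).
  specialize (hn0 m (Nat.le_max_l n0 t)); apply Rabs_def2 in hn0.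
  assert (hBm : Ft m B) by (apply (Ft_mono t); [apply Nat.le_max_r | exact hB]).
  pose proof (V_stays_forever m B L hBm hAL) as h1.
  (* A path in [B] that stays close from [m] on is outside [osc], hence in the symmetric
     difference. *)
  assert (h2 : V (fun v => B v /\ forall n, stays eps m n v) <= V sd).
  { apply V_mono; auto.
    - apply (sigma_and _ _ hs); auto; apply Finf_stays.
    - intros w [hw1 hw2] [_ h]; exact (h hw1 m hw2). }
  assert (h3 : V osc <= V B + V sd).
  { eapply Rle_trans; [|apply V_or; auto].
    apply V_mono; auto; [apply (sigma_or _ _ hs); auto|].
    intros w hw; unfold sd; tauto. }
  assert (h4 : V B <= d / 2).
  { assert (hp : 0 < eps ^ 2) by (apply pow_lt, heps).
    apply Rmult_le_reg_l with (eps ^ 2); [exact hp|].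
    pose proof (Rmult_le_compat_l _ _ _ (Rlt_le _ _ hp) (Rlt_le _ _ (Rle_lt_trans _ _ _ h2 hBV))).
    lra. }
  lra.
Qed.

End Series.
End Expectation.

(** * Quasi-sure convergence *)

Theorem theorem4p2 (Omega : Type) (Ft : nat -> (Omega -> Prop) -> Prop)
  (H : (Omega -> R) -> Prop) (E : nat -> (Omega -> R) -> Omega -> R)
  (X : nat -> Omega -> R) :
  filtration Ft -> admissible_space Ft H -> SL_expectation Ft H E ->
  (forall i : nat, (1 <= i)%nat ->
     Ht Ft H i (X i) /\ indep_of_F Ft H E (X i) (i - 1)%nat /\
     ((exists c : R, forall w, c <= X i w) \/ L1b H E (X i))) ->
  (* sum_{i>=1} E((X_i - E X_i)^2) < infinity, with E of the nonnegative
     function (X_i - E X_i)^2 read as sup{ E(Z) : Z in H, 0 <= Z <= (X_i - E X_i)^2 } *)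
  (exists Sb : R, forall (n : nat) (Z : nat -> Omega -> R),
     (forall i, H (Z i) /\ forall w, 0 <= Z i w <= (X i w - E 0%nat (X i) w) ^ 2) ->
     forall w, sum_f_R0 (fun k => E 0%nat (Z (S k)) w) n <= Sb) ->
  quasi_surely Ft E (fun w => exists l : R,
     Un_cv (fun n => sum_f_R0 (fun k => X (S k) w - E 0%nat (X (S k)) w) n) l).
Proof.
  intros hFt hH hE hX [Sb hSb].
  destruct (classic (inhabited Omega)) as [[w0] | hempty].
  (* With [Omega] empty there is no base point [w0], and all pointwise claims are vacuous. *)
  2: { exists (fun _ => True); split; [apply sigma_true, Finf_sigma|].
       split; intros w; exfalso; apply hempty; exact (inhabits w). }
  assert (hX' : forall i, Ht Ft H (S i) (X (S i)) /\ indep_of_F Ft H E (X (S i)) i).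
  { intros i; destruct (hX (S i)) as [h1 [h2 _]]; [lia|].
    rewrite Nat.sub_succ, Nat.sub_0_r in h2; auto. }
  assert (hEX : forall i w, E 0%nat (X (S i)) w = E 0%nat (X (S i)) w0)
    by (intros i w; apply (E0_const _ _ _ _ w0 hFt hE), hX').
  assert (hY : forall i, Ht Ft H (S i) (fun w => X (S i) w - E 0%nat (X (S i)) w0)).
  { intros i; pose proof (Ft_sigma _ _ hFt (S i)) as hs; split.
    - apply (H_shift _ _ _ hH), hX'.
    - apply (measurable_sub _ _ hs); [apply hX' | apply (measurable_const _ _ hs)]. }
  set (osc := fun j w => forall m, ~ forall n, stays Omega E w0 X (/ INR (S j)) m n w).
  assert (hosc : forall j, Finf Ft (osc j) /\ E 0%nat (ind (osc j)) w0 = 0).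
  { intros j; assert (heps : 0 < / INR (S j)) by apply Rinv_0_lt_compat, lt_0_INR, Nat.lt_0_succ.
    assert (heta : forall i, 0 < (1 / 2) ^ i) by (intros i; apply pow_lt; lra).
    set (d := fun i => constructive_indefinite_description _
      (truncated_square Omega Ft H E w0 hFt hH (S i) _ (/ INR (S j)) ((1 / 2) ^ S i)
         (hY i) heps (heta (S i)))).
    set (q := fun i => proj1_sig (d i)); pose proof (fun i => proj2_sig (d i)) as hq.
    cbv beta in hq.
    (* Index 0 lies outside the series; the value 0 there keeps [Q] admissible in [hSb], which
       constrains every index. *)
    set (Q := fun i => match i with O => fun _ : Omega => 0 | S k => q k end).
    refine (oscillation_null Omega Ft H E w0 hFt hH hE X hX' (/ INR (S j))
      (fun i => (1 / 2) ^ i) Q heps heta _ _).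
    - intros i; destruct (hq i) as [h1 [h2 h3]]; split; [exact h1|]; split; [|exact h3].
      intros w; apply h2.
    - assert (hQ0 : forall i, 0 <= E 0%nat (Q (S i)) w0)
        by (intros i; apply (e_nonneg _ Ft H E w0 hFt hH hE); apply (hq i)).
      (* The slacks [(1 / 2) ^ i] sum to at most 1 and enter [A] doubled, hence the 2. *)
      exists (Sb + 2); intros n; rewrite psum_add, psum_scal.
      pose proof (psum_half n) as h1.
      (* The truncated squares are among the test functions [Z] over which the hypothesis takes its
         supremum. *)
      assert (h2 : psum (fun i => E 0%nat (Q i) w0) (S n) <= Sb).
      { rewrite psum_sum_f_R0; apply (hSb n Q); intros [|i].
        - split; [exact (H_const _ _ hH 0) | intros w; simpl Q; split; [lra | apply pow2_ge_0]].
        - destruct (hq i) as [h3 [h4 _]]; split; [apply h3|].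
          intros w; rewrite hEX; apply h4. }
      (* [hSb] at [n] bounds [psum] at [S n]; dropping the last, nonnegative term gives [n]. *)
      cbn [psum] in h2; specialize (hQ0 n); cbv beta; lra. }
  exists (fun w => exists j, osc j w); split; [|split].
  - apply (sigma_ex _ _ (Finf_sigma Omega Ft)); apply hosc.
  - intros w; rewrite (E0_const _ _ _ _ w0 hFt hE).
    + apply (null_union Omega Ft H E w0 hFt hH hE osc); apply hosc.
    + apply (H_indicator _ _ _ hH), (sigma_ex _ _ (Finf_sigma Omega Ft)); apply hosc.
  - intros w hw.
    assert (hC : Cauchy_crit (fun n => sum_f_R0 (fun k => X (S k) w - E 0%nat (X (S k)) w) n)).
    { intros d hd; destruct (archimed_cor1 (d / 2)) as [j [hj hj0]]; [lra|].
      assert (hm : exists m, forall n, stays Omega E w0 X (/ INR j) m n w).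
      { apply NNPP; intros hno; apply hw; exists (pred j); intros m hm; apply hno.
        exists m; replace (S (pred j)) with j in hm by lia; exact hm. }
      destruct hm as [m hm].
      (* All late partial sums lie within [d / 2] of the one at [m], hence within [d] of each
         other. *)
      assert (hs : forall n, (n >= m)%nat -> Rabs (sum_f_R0 (fun k => X (S k) w - E 0%nat (X (S k)) w) n
        - psum (fun i => X i w - E 0%nat (X i) w0) m) < d / 2).
      { intros n hn; eapply Rle_lt_trans; [|exact hj].
        pose proof (hm (S n - m)%nat (S n - m)%nat (le_n _)) as h.
        replace (S n - m + m)%nat with (S n) in h by lia.
        rewrite psum_sum_f_R0 in h; erewrite (sum_eq (fun k => X (S k) w - E 0%nat (X (S k)) w));
          [exact h|]; intros i _; cbv beta; rewrite hEX; reflexivity. }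
      exists m; intros n p hn hp; pose proof (hs n hn); pose proof (hs p hp).
      unfold Rdist; unfold Rabs in *; repeat destruct Rcase_abs; lra. }
    destruct (R_complete _ hC) as [l hl]; exists l; exact hl.
Qed.
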